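(* The superport response matrix $L$ satisfies $$L=(D^{T}K^{-1}D)^{-1}.$$
   Context: Network. $G=(V,E)$ is a finite connected simple undirected graph; each edge $e$ has a conductance $c_e\in\mathbb R_{>0}$. The weighted Laplacian $L_c$ is the $V\times V$ matrix with $(L_c)_{uu}=\sum_{e\ni u}c_e$, $(L_c)_{uv}=-c_{uv}$ if $uv\in E$, and $0$ otherwise. Superports. The boundary $M\subseteq V$ is nonempty and partitioned into nonempty superports $M=A_1\sqcup\cdots\sqcup A_p$. Choose a root $r_a\in A_a$ for each $a$; $R=\{r_1,\dots,r_p\}$, $N=M\setminus R$, $q=|N|$, $N=(x_1,\dots,x_q)$ in a fixed order; $r(x)$ is the root of the superport containing $x$. Fix a ground root $g\in R$. $K=L_c[V\setminus\{g\},V\setminus\{g\}]$ is the Laplacian with the row and column of $g$ deleted. In $\mathbb R^{V\setminus\{g\}}$ with standard basis $(e_v)$ and the convention $e_g=0$, let $D$ be the matrix whose columns are $d_x=e_x-e_{r(x)}$, $x\in N$, in the fixed order. Superport response. Given $y\in\mathbb R^N$, consider voltages $U\in\mathbb R^V$ with $U_x-U_{r(x)}=y_x$ for all $x\in N$ whose incoming-current vector $\iota=L_cU$ satisfies $\iota_v=0$ for $v\notin M$ and $\sum_{v\in A_a}\iota_v=0$ for every $a$. Put $j_x=\iota_x$ for $x\in N$ (the independent incoming currents). The linear map $y\mapsto j$ is the superport response and $L$ is its $q\times q$ matrix in the chosen ordered root coordinates: $j=Ly$. *)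

(* Defs.v *)
From HB Require Import structures.
From mathcomp Require Import all_boot all_order all_algebra.
From mathcomp Require Import reals.

Set Implicit Arguments.
Unset Strict Implicit.
Unset Printing Implicit Defensive.

Import Order.TTheory GRing.Theory Num.Theory.
Local Open Scope ring_scope.

(* A graph on V is given by its set E of edges, an edge being the 2-element
   set of its endpoints; parallel edges and loops are thus impossible. *)
Definition simple_graph (V : finType) (E : {set {set V}}) : Prop :=
  forall e, e \in E -> #|e| = 2%N.

Definition connected_graph (V : finType) (E : {set {set V}}) : Prop :=
  forall u v, connect [rel s t | [set s; t] \in E] u v.

(* The values of c outside E play no role. *)
Definition laplacian (R : realType) (V : finType) (E : {set {set V}})
    (c : {set V} -> R) (u v : V) : R :=
  if u == v then \sum_(e in E | u \in e) c e
  else if [set u; v] \in E then - c [set u; v] else 0.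

Definition incoming_current (R : realType) (V : finType) (E : {set {set V}})
    (c : {set V} -> R) (U : V -> R) (v : V) : R :=
  \sum_w laplacian E c v w * U w.

(* Matrices and vectors indexed by V \ {g} are indexed by 'I_#|[set~ g]|
   through the enumeration enum_val of [set~ g]. *)
Definition grounded_laplacian (R : realType) (V : finType)
    (E : {set {set V}}) (c : {set V} -> R) (g : V) : 'M[R]_#|[set~ g]| :=
  \matrix_(i, j) laplacian E c (enum_val i) (enum_val j).

(* As g is not in [set~ g], the convention e_g = 0 holds by construction. *)
Definition basis_vector (R : realType) (V : finType) (g v : V) :
    'cV[R]_#|[set~ g]| :=
  \col_i (enum_val i == v)%:R.

(* The superports are the blocks of a partition P of M, and rt selects a root
   in each block. *)
Definition superport_roots (V : finType) (P : {set {set V}}) (rt : {set V} -> V) :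
    {set V} :=
  rt @: P.

Definition root_of (V : finType) (P : {set {set V}}) (rt : {set V} -> V)
    (v : V) : V :=
  rt (pblock P v).

Definition port_matrix (R : realType) (V : finType) (P : {set {set V}})
    (rt : {set V} -> V) (q : nat) (x : q.-tuple V) (g : V) :
    'M[R]_(#|[set~ g]|, q) :=
  \matrix_(i, k) (basis_vector R g (tnth x k)
                  - basis_vector R g (root_of P rt (tnth x k))) i 0.

Definition admissible_voltage (R : realType) (V : finType)
    (E : {set {set V}}) (c : {set V} -> R) (M : {set V}) (P : {set {set V}})
    (rt : {set V} -> V) (q : nat) (x : q.-tuple V)
    (y : 'cV[R]_q) (U : V -> R) : Prop :=
  [/\ forall k, U (tnth x k) - U (root_of P rt (tnth x k)) = y k 0,
      forall v, v \notin M -> incoming_current E c U v = 0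
    & forall A, A \in P -> \sum_(v in A) incoming_current E c U v = 0].

Definition superport_response (R : realType) (V : finType)
    (E : {set {set V}}) (c : {set V} -> R) (M : {set V}) (P : {set {set V}})
    (rt : {set V} -> V) (q : nat) (x : q.-tuple V)
    (y j : 'cV[R]_q) : Prop :=
  exists U : V -> R,
    admissible_voltage E c M P rt x y U /\
    j = \col_k incoming_current E c U (tnth x k).

(* The relation superport_response is the graph of the linear map y |-> L y;
   this includes that every y has a response and that it is unique. *)
Definition superport_response_matrix (R : realType) (V : finType)
    (E : {set {set V}}) (c : {set V} -> R) (M : {set V}) (P : {set {set V}})
    (rt : {set V} -> V) (q : nat) (x : q.-tuple V) (L : 'M[R]_q) : Prop :=
  forall y j : 'cV[R]_q,
    superport_response E c M P rt x y j <-> j = L *m y.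

(* Main.v *)
(* The Dirichlet energy [\sum_v U v * (L_c U) v] is a sum of squares over edges,
   so on a connected graph it vanishes only for constant voltages; this makes
   both [K] and [D^T K^-1 D] injective.  A current vector that satisfies the
   superport constraints is determined by its values [j] on the non-root
   boundary vertices and equals [D j] off the ground.  Grounding a voltage at
   [g] therefore turns admissibility into [K u = D j] and [D^T u = y], that is
   [y = D^T K^-1 D j]. *)
Require Import Defs.
From HB Require Import structures.
From mathcomp Require Import all_boot all_order all_algebra.
From mathcomp Require Import reals.
From mathcomp Require Import ring lra.

Set Implicit Arguments.
Unset Strict Implicit.
Unset Printing Implicit Defensive.

Import Order.TTheory GRing.Theory Num.Theory.
Local Open Scope ring_scope.

(** [row_free] concerns the left kernel, so the criterion is applied to the transpose of [A]. *)
Lemma unitmx_injective (F : fieldType) n (A : 'M[F]_n) :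
  (forall u : 'cV_n, A *m u = 0 -> u = 0) -> A \in unitmx.
Proof.
move=> Ainj; rewrite -unitmx_tr -row_free_unit -kermx_eq0; apply/rowV0P => v.
move=> /sub_kermxP vA0; apply: trmx_inj; rewrite trmx0; apply: Ainj.
by rewrite -[A]trmxK -trmx_mul vA0 trmx0.
Qed.

(** * Currents and Dirichlet energy of the network *)

Section Network.
Variables (R : realType) (V : finType) (E : {set {set V}}) (c : {set V} -> R).
Hypothesis simpleE : simple_graph E.

(** Conductances extended by zero to all ordered pairs, so that sums over edges become double sums
    over vertices. *)
Definition edge_weight (u v : V) : R :=
  if [set u; v] \in E then c [set u; v] else 0.

Lemma edge_weightC u v : edge_weight u v = edge_weight v u.
Proof. by rewrite /edge_weight setUC. Qed.

Lemma edge_weightxx u : edge_weight u u = 0.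
Proof.
rewrite /edge_weight; case: ifP => // /simpleE.
by rewrite setUid cards1.
Qed.

Lemma edge_neq u v : [set u; v] \in E -> u != v.
Proof. by move=> /simpleE; rewrite cards2; case: eqP. Qed.

(** Edges have exactly two ends, so [v |-> [set u; v]] is a bijection from the neighbours of [u] to
    the edges at [u]. *)
Lemma sum_incident_edges u :
  \sum_(e in E | u \in e) c e = \sum_v edge_weight u v.
Proof.
rewrite /edge_weight -big_mkcond /=.
have -> : \sum_(v | [set u; v] \in E) c [set u; v] =
          \sum_(v in [set v | [set u; v] \in E]) c [set u; v].
  by apply: eq_bigl => v; rewrite inE.
rewrite -(big_imset c (h := fun v => [set u; v])) /=; last first.
  move=> v w; rewrite !inE => /edge_neq uv /edge_neq uw eq_vw.
  have : v \in [set u; w] by rewrite -eq_vw set22.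
  by rewrite !inE eq_sym (negPf uv) => /eqP.
apply: eq_bigl => e; apply/andP/imsetP => [[eE ue]|[v]]; last first.
  by rewrite inE => uvE ->; rewrite uvE set21.
have /cards2P [a [b [_ def_e]]] : #|e| == 2%N by rewrite simpleE.
move: ue; rewrite def_e !inE => /orP[] /eqP ->.
  by exists b; rewrite // inE -def_e.
by exists a; rewrite ?inE setUC -?def_e.
Qed.

Lemma incoming_currentE (U : V -> R) v :
  incoming_current E c U v = \sum_w edge_weight v w * (U v - U w).
Proof.
rewrite /incoming_current (eq_bigr (fun w =>
  (if w == v then (\sum_t edge_weight v t) * U v else 0)
  - edge_weight v w * U w)); last first.
  move=> w _; rewrite /laplacian eq_sym; case: eqP => [->|_].
    by rewrite sum_incident_edges edge_weightxx mul0r subr0.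
  by rewrite sub0r /edge_weight; case: ifP => _; rewrite ?mulNr ?mul0r ?oppr0.
rewrite sumrB -big_mkcond big_pred1_eq mulr_suml -sumrB.
by apply: eq_bigr => w _; rewrite mulrBr.
Qed.

Lemma incoming_currentB (U : V -> R) a v :
  incoming_current E c (fun w => U w - a) v = incoming_current E c U v.
Proof.
rewrite !incoming_currentE; apply: eq_bigr => w _; congr (_ * _); ring.
Qed.

(** The flow between two vertices is antisymmetric, so exchanging the two summations changes the
    sign of the sum. *)
Lemma sum_incoming_current (U : V -> R) : \sum_v incoming_current E c U v = 0.
Proof.
set S := \sum_v _; suff: S = - S by lra.
rewrite {1}/S (eq_bigr _ (fun v _ => incoming_currentE U v)).
rewrite exchange_big -sumrN; apply: eq_bigr => v _.
rewrite incoming_currentE -sumrN; apply: eq_bigr => w _.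
rewrite edge_weightC; ring.
Qed.

(** Adding the double sum to its copy with [v] and [w] exchanged completes the square; the factor 2
    arises because each edge is counted in both directions. *)
Lemma double_energyE (U : V -> R) :
  2 * (\sum_v U v * incoming_current E c U v) =
  \sum_v \sum_w edge_weight v w * (U v - U w) ^+ 2.
Proof.
set S := \sum_v _ * _.
have S1 : S = \sum_v \sum_w edge_weight v w * (U v * (U v - U w)).
  apply: eq_bigr => v _; rewrite incoming_currentE mulr_sumr.
  by apply: eq_bigr => w _; ring.
have S2 : S = \sum_v \sum_w edge_weight v w * (U w * (U w - U v)).
  rewrite S1 exchange_big; apply: eq_bigr => v _; apply: eq_bigr => w _.
  by rewrite edge_weightC.
rewrite mulr2n mulrDl mul1r {1}S1 S2 -big_split; apply: eq_bigr => v _ /=.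
by rewrite -big_split; apply: eq_bigr => w _ /=; ring.
Qed.

Hypothesis connE : connected_graph E.
Hypothesis c_gt0 : forall e, e \in E -> 0 < c e.

Lemma energy0_constant (U : V -> R) :
  \sum_v U v * incoming_current E c U v = 0 -> forall u v, U u = U v.
Proof.
move=> energy0; have w_ge0 u v : 0 <= edge_weight u v.
  by rewrite /edge_weight; case: ifP => // /c_gt0 /ltW.
have term_ge0 u v : 0 <= edge_weight u v * (U u - U v) ^+ 2.
  by rewrite mulr_ge0 // sqr_ge0.
have edgeU u v : [set u; v] \in E -> U u = U v.
  move=> uvE; have /esym/eqP := double_energyE U; rewrite energy0 mulr0.
  (* A vanishing sum of nonnegative terms has only zero terms, and [c] is positive on the edge. *)
  rewrite psumr_eq0 => [|s _]; last by apply: sumr_ge0.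
  move=> /allP /(_ u (mem_index_enum u)); rewrite psumr_eq0 => [|s _ //].
  move=> /allP /(_ v (mem_index_enum v)); rewrite /= /edge_weight uvE.
  by rewrite mulf_eq0 gt_eqF ?c_gt0 // sqrf_eq0 subr_eq0 => /eqP.
move=> u v; have /connectP [p] := connE u v.
elim: p u => [|s p IHp] u /=; first by move=> _ ->.
by case/andP=> /edgeU -> sp /(IHp _ sp).
Qed.

(** * Grounding at [g] and positive definiteness of [K] *)

Variable g : V.
Implicit Type u : 'cV[R]_#|[set~ g]|.

Lemma enum_val_neq (i : 'I_#|[set~ g]|) : enum_val i != g.
Proof. by have := enum_valP i; rewrite !inE. Qed.

Lemma enum_val_surj v : v != g -> exists i : 'I_#|[set~ g]|, v = enum_val i.
Proof.
move=> vg; have gv : v \in [set~ g] by rewrite !inE.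
by exists (enum_rank_in gv v); rewrite enum_rankK_in.
Qed.

(** Extension of [u] by zero at [g]. The indicator form pairs [u] with [basis_vector], so products
    with [D^T] can be read off termwise. *)
Definition grounded_voltage u (v : V) : R :=
  \sum_i (enum_val i == v)%:R * u i 0.

Lemma grounded_voltage_ground u : grounded_voltage u g = 0.
Proof.
by apply: big1 => i _; rewrite (negPf (enum_val_neq i)) mul0r.
Qed.

Lemma grounded_voltage_enum_val u i : grounded_voltage u (enum_val i) = u i 0.
Proof.
rewrite /grounded_voltage (bigD1 i) //= eqxx mul1r big1 ?addr0 // => j ji.
by rewrite (inj_eq enum_val_inj) (negPf ji) mul0r.
Qed.

Lemma sum_off_ground (f : V -> R) :
  \sum_(i < #|[set~ g]|) f (enum_val i) = \sum_(v | v != g) f v.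
Proof.
rewrite -(big_enum_val f); apply: eq_bigl => v; by rewrite !inE.
Qed.

Lemma grounded_laplacian_mul u i :
  (grounded_laplacian E c g *m u) i 0 =
  incoming_current E c (grounded_voltage u) (enum_val i).
Proof.
rewrite mxE /incoming_current (bigD1 g) //= grounded_voltage_ground mulr0 add0r.
rewrite -(sum_off_ground (fun v =>
  laplacian E c (enum_val i) v * grounded_voltage u v)).
by apply: eq_bigr => j _; rewrite mxE grounded_voltage_enum_val.
Qed.

Lemma grounded_energyE u :
  (u^T *m (grounded_laplacian E c g *m u)) 0 0 =
  \sum_v grounded_voltage u v * incoming_current E c (grounded_voltage u) v.
Proof.
rewrite mxE [RHS](bigD1 g) //= grounded_voltage_ground mul0r add0r.
rewrite -(sum_off_ground (fun v => grounded_voltage u v *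
  incoming_current E c (grounded_voltage u) v)).
apply: eq_bigr => i _.
by rewrite mxE grounded_laplacian_mul grounded_voltage_enum_val.
Qed.

(** Zero energy makes the extended voltage constant, and its value at the ground is 0. *)
Lemma grounded_energy_eq0 u :
  u^T *m (grounded_laplacian E c g *m u) = 0 -> u = 0.
Proof.
move=> /matrixP /(_ 0 0); rewrite grounded_energyE mxE => energy0.
apply/matrixP => i j; rewrite ord1 mxE -grounded_voltage_enum_val.
by rewrite (energy0_constant energy0 _ g) grounded_voltage_ground.
Qed.

Lemma grounded_laplacian_unit : grounded_laplacian E c g \in unitmx.
Proof.
apply: unitmx_injective => u Ku0; apply: grounded_energy_eq0.
by rewrite Ku0 mulmx0.
Qed.

(** * Superports and the currents they carry *)

Variables (M : {set V}) (P : {set {set V}}) (rt : {set V} -> V).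
Variables (q : nat) (x : q.-tuple V).
Hypothesis partP : partition P M.
Hypothesis rtP : forall A, A \in P -> rt A \in A.
Hypothesis uniq_x : uniq x.
Hypothesis xE : x =i M :\: superport_roots P rt.
Hypothesis g_root : g \in superport_roots P rt.

Local Notation D := (port_matrix R P rt x g).
Local Notation K := (grounded_laplacian E c g).

Lemma tnth_boundary k : tnth x k \in M.
Proof. by have := mem_tnth k x; rewrite xE inE => /andP[]. Qed.

Lemma tnth_nonroot k : tnth x k \notin superport_roots P rt.
Proof. by have := mem_tnth k x; rewrite xE inE => /andP[]. Qed.

Lemma tnth_neq_ground k : tnth x k != g.
Proof. by apply: contraNneq (tnth_nonroot k) => ->. Qed.

Lemma pblock_tnth k : pblock P (tnth x k) \in P.
Proof. by rewrite pblock_mem // (cover_partition partP) tnth_boundary. Qed.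

Lemma root_of_root k : root_of P rt (tnth x k) \in superport_roots P rt.
Proof. exact/imset_f/pblock_tnth. Qed.

Lemma mem_root_of k A : A \in P -> (root_of P rt (tnth x k) \in A) = (tnth x k \in A).
Proof.
have [_ tI _] := and3P partP => AP.
have rB := rtP (pblock_tnth k); have xB : tnth x k \in pblock P (tnth x k).
  by rewrite mem_pblock (cover_partition partP) tnth_boundary.
apply/idP/idP => [rA|xA].
  by rewrite -(def_pblock tI AP rA) (def_pblock tI (pblock_tnth k) rB).
by rewrite /root_of (def_pblock tI AP xA) rtP.
Qed.

(** The vector [D j] extended to all of [V]: at [g], where [D] has no row, it gives the current that
    balances the ground superport. *)
Definition port_current (j : 'cV[R]_q) (v : V) : R :=
  \sum_k ((v == tnth x k)%:R - (v == root_of P rt (tnth x k))%:R) * j k 0.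

Lemma port_matrix_mul j i : (D *m j) i 0 = port_current j (enum_val i).
Proof. by rewrite mxE; apply: eq_bigr => k _; rewrite !mxE. Qed.

Lemma port_matrix_tr_mul u k :
  (D^T *m u) k 0 = grounded_voltage u (tnth x k)
                   - grounded_voltage u (root_of P rt (tnth x k)).
Proof.
by rewrite mxE -sumrB; apply: eq_bigr => i _; rewrite !mxE mulrBl.
Qed.

(** No [tnth x k] is a root and the tuple has no repetition, so only the term of index [k]
    survives. *)
Lemma port_current_tnth j k : port_current j (tnth x k) = j k 0.
Proof.
have nr l : (tnth x k == root_of P rt (tnth x l)) = false.
  by apply: contraNF (tnth_nonroot k) => /eqP ->; apply: root_of_root.
rewrite /port_current (bigD1 k) //= eqxx nr subr0 mul1r big1 ?addr0 // => l lk.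
have /tuple_uniqP x_inj := uniq_x.
by rewrite nr (inj_eq x_inj) eq_sym (negPf lk) subr0 mul0r.
Qed.

Lemma port_current_off_boundary j v : v \notin M -> port_current j v = 0.
Proof.
move=> vM; apply: big1 => k _.
have [vx|_] := eqVneq v (tnth x k); first by rewrite vx tnth_boundary in vM.
have [vr|_] := eqVneq v _; last by rewrite subr0 mul0r.
case/negP: vM; rewrite -(cover_partition partP) vr.
apply/bigcupP; exists (pblock P (tnth x k)); first exact: pblock_tnth.
exact/rtP/pblock_tnth.
Qed.

Lemma sum_indicator (A : {pred V}) s :
  \sum_(v in A) (v == s)%:R = (s \in A)%:R :> R.
Proof.
rewrite -natr_sum; congr _%:R; rewrite big_mkcond (bigD1 s) //= eqxx.
rewrite big1 ?addn0; first by case: ifP.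
by move=> v /negPf ->; case: ifP.
Qed.

(** Each port adds and removes the same current inside [A]. This serves both for a superport and for
    the whole of [V]. *)
Lemma sum_port_current j (A : {pred V}) :
  (forall k, (root_of P rt (tnth x k) \in A) = (tnth x k \in A)) ->
  \sum_(v in A) port_current j v = 0.
Proof.
move=> rA; rewrite exchange_big big1 //= => k _.
by rewrite -mulr_suml sumrB !sum_indicator rA subrr mul0r.
Qed.

(** Within a superport only the root can carry a nonzero value, and that value is then the sum over
    the block. Applied to a difference, this shows that a current is determined by [j]. *)
Lemma boundary_current_eq0 (h : V -> R) :
    (forall v, v \notin M -> h v = 0) ->
    (forall A, A \in P -> \sum_(v in A) h v = 0) ->
    (forall k, h (tnth x k) = 0) ->
  forall v, h v = 0.
Proof.
have [/eqP covP tI _] := and3P partP.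
move=> hM hP hx; have nonroot v : v \notin superport_roots P rt -> h v = 0.
  move=> vr; have [vM|/hM //] := boolP (v \in M).
  have /tnthP [k ->] : v \in x by rewrite xE inE vr.
  exact: hx.
move=> v; have [/imsetP [A AP ->]|/nonroot //] := boolP (v \in superport_roots P rt).
have := hP A AP; rewrite (bigD1 (rt A)) ?rtP //= big1 ?addr0 // => w /andP[wA wr].
apply: nonroot; apply: contraNN wr => /imsetP [B BP wB].
(* A root lying in [A] is the root of [A], since blocks are disjoint. *)
suff -> : A = B by rewrite wB.
by rewrite -(def_pblock tI AP wA) (def_pblock tI BP) // wB rtP.
Qed.

Lemma port_matrix_inj (j : 'cV[R]_q) : D *m j = 0 -> j = 0.
Proof.
move=> Dj0; apply/matrixP => k l; rewrite ord1 mxE -port_current_tnth.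
have [i ->] := enum_val_surj (tnth_neq_ground k).
by rewrite -port_matrix_mul Dj0 mxE.
Qed.

(** * Invertibility of [D^T K^-1 D] and the response relation *)

Lemma port_schur_unit : D^T *m invmx K *m D \in unitmx.
Proof.
apply: unitmx_injective => j; set u := invmx K *m (D *m j).
have Ku : K *m u = D *m j by rewrite mulKVmx // grounded_laplacian_unit.
rewrite -!mulmxA -/u => Du0; apply: port_matrix_inj; rewrite -Ku.
clearbody u.
suff -> : u = 0 by rewrite mulmx0.
(* The energy of [u] is, after transposition, [j^T (D^T u)], which vanishes by [Du0]. *)
apply: grounded_energy_eq0; apply: trmx_inj.
by rewrite Ku !trmx_mul trmxK -mulmxA Du0 mulmx0 trmx0.
Qed.

Lemma superport_responseP y j :
  superport_response E c M P rt x y j <-> y = D^T *m invmx K *m D *m j.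
Proof.
have Kunit := grounded_laplacian_unit; split=> [[U [[Uy UM UP] def_j]]|def_y].
  (* Subtracting the constant [U g] grounds the voltage and changes neither currents nor voltage
     differences. *)
  pose u : 'cV_#|[set~ g]| := \col_i (U (enum_val i) - U g).
  have uE v : grounded_voltage u v = U v - U g.
    have [->|/enum_val_surj [i ->]] := eqVneq v g.
      by rewrite grounded_voltage_ground subrr.
    by rewrite grounded_voltage_enum_val mxE.
  have currentE v : incoming_current E c U v = port_current j v.
    apply/eqP; rewrite -subr_eq0; apply/eqP; move: v.
    apply: boundary_current_eq0 => [v vM|A AP|k].
    - by rewrite UM // port_current_off_boundary // subr0.
    - rewrite sumrB UP // sum_port_current ?subr0 // => k.
      exact: mem_root_of.
    - by rewrite port_current_tnth def_j mxE subrr.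
  have Ku : K *m u = D *m j.
    apply/matrixP => i l; rewrite ord1 grounded_laplacian_mul port_matrix_mul.
    rewrite -currentE -(incoming_currentB U (U g)).
    by apply: eq_bigr => w _; rewrite uE.
  rewrite -!mulmxA -Ku mulKmx //; apply/matrixP => k l; rewrite ord1.
  rewrite port_matrix_tr_mul !uE -Uy; ring.
pose u := invmx K *m (D *m j); pose U := grounded_voltage u.
have off_ground v : v != g -> incoming_current E c U v = port_current j v.
  move=> /enum_val_surj [i ->].
  by rewrite -grounded_laplacian_mul mulKVmx // port_matrix_mul.
(* The equation [K u = D j] says nothing at [g]; there the currents agree because both have total
   sum zero over [V]. *)
have currentE v : incoming_current E c U v = port_current j v.
  have [->|/off_ground //] := eqVneq v g.
  have := sum_incoming_current U.
  have : \sum_(v in V) port_current j v = 0 by apply: sum_port_current.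
  rewrite (bigD1 g) //= [in X in _ -> X -> _](bigD1 g) //=.
  rewrite [in X in _ -> X -> _](eq_bigr (port_current j)) //.
  move=> portS currentS; lra.
exists U; split; last first.
  by apply/matrixP => k l; rewrite ord1 mxE currentE port_current_tnth.
split=> [k|v vM|A AP].
- by rewrite -port_matrix_tr_mul def_y -!mulmxA.
- by rewrite currentE port_current_off_boundary.
- rewrite (eq_bigr _ (fun v _ => currentE v)) sum_port_current // => k.
  exact: mem_root_of.
Qed.

Lemma superport_response_matrix_schur :
  superport_response_matrix E c M P rt x (invmx (D^T *m invmx K *m D)).
Proof.
move=> y j; rewrite superport_responseP.
have Gunit := port_schur_unit.
by split=> ->; rewrite ?mulKmx ?mulKVmx.
Qed.

End Network.

Theorem proposition2p2 (R : realType) (V : finType)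
    (E : {set {set V}}) (c : {set V} -> R)
    (M : {set V}) (P : {set {set V}}) (rt : {set V} -> V)
    (q : nat) (x : q.-tuple V) (g : V)
    (simpleE : simple_graph E) (connE : connected_graph E)
    (c_gt0 : forall e, e \in E -> 0 < c e)
    (M_neq0 : M != set0) (partP : partition P M)
    (rtP : forall A, A \in P -> rt A \in A)
    (uniq_x : uniq x) (xE : x =i M :\: superport_roots P rt)
    (g_root : g \in superport_roots P rt) :
  let K := grounded_laplacian E c g in
  let D := port_matrix R P rt x g in
  [/\ K \in unitmx,
      D^T *m invmx K *m D \in unitmx,
      exists L : 'M[R]_q, superport_response_matrix E c M P rt x L
    & forall L : 'M[R]_q, superport_response_matrix E c M P rt x L ->
        L = invmx (D^T *m invmx K *m D)].
Proof.
have LP := superport_response_matrix_schur simpleE connE c_gt0 partP rtP uniq_x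
  xE g_root.
move=> K D; split; first exact: grounded_laplacian_unit.
- exact: (port_schur_unit simpleE connE c_gt0 partP uniq_x xE g_root).
- by exists (invmx (D^T *m invmx K *m D)).
(* Columns are compared: the [k]-th column is the response to the [k]-th unit vector, and both
   matrices describe the same relation. *)
- move=> L respL; apply: trmx_inj; apply/row_matrixP => k; rewrite -!tr_col.
  congr _^T; rewrite !colE.
  by apply/(LP _ _)/(respL _ _).
Qed.
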